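(* For each nonnegative integer $k$, the maps $\mathrm{swu}:\mathcal U_{2k+1}(231)\to\mathcal U_{2k+1}(132)$ and $\mathrm{swd}:\mathcal U_{2k+1}(132)\to\mathcal U_{2k+1}(231)$ are well defined bijections that are inverses of each other.
   Context: Permutations are finite words of distinct positive integers; $S_n$ is the set of permutations of $[n]$. The stack-sorting map $s$: $s(\text{empty})=\text{empty}$, and if $\pi=LnR$ with $n$ the largest entry, $s(\pi)=s(L)s(R)n$. A permutation is uniquely sorted if it has exactly one preimage under $s$. A permutation avoids $\tau$ if no subsequence has the same relative order as $\tau$; $\mathcal U_n(\tau)$ is the set of uniquely sorted permutations in $S_n$ avoiding $\tau$. $\mathrm{rev}$ reverses a word. Sliding operators: for $\pi\in S_n$ and $i\in[n]$, let $L_i$ (resp. $R_i$) be the set of elements of $[i-1]$ lying to the left (resp. right) of the entry $i$ in $\pi$. Define $\mathrm{swu}_i(\pi)$ entrywise: if $\pi_j\ge i$ its $j$-th entry is $\pi_j$; if $\pi_j$ is the $m$-th smallest element of $R_i$ its $j$-th entry is $m$; if $\pi_j$ is the $m$-th largest element of $L_i$ its $j$-th entry is $i-m$. Let $\mathrm{swd}_i(\pi)=\mathrm{rev}(\mathrm{swu}_i(\mathrm{rev}(\pi)))$. Define $\mathrm{swu}=\mathrm{swu}_1\circ\mathrm{swu}_2\circ\cdots\circ\mathrm{swu}_n$ and $\mathrm{swd}=\mathrm{swd}_1\circ\cdots\circ\mathrm{swd}_n$ on $S_n$. *)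

(* Defs.v *)
From mathcomp Require Import all_boot.
From mathcomp Require Import boolp classical_sets functions.

Set Implicit Arguments.
Unset Strict Implicit.
Unset Printing Implicit Defensive.

Local Open Scope classical_set_scope.

Definition is_word (w : seq nat) : bool := uniq w && all (ltn 0) w.

Definition is_perm (n : nat) (w : seq nat) : bool := perm_eq w (iota 1 n).

Definition max_entry (w : seq nat) : nat := foldr maxn 0 w.

(* The first argument is fuel, needed only because the recursive calls are on
   the factors L and R of L ++ n :: R; any value at least [size w] gives the
   same result ([stack_sort_rec_fuel]), and the recursive equations are
   [stack_sort_nil] and [stack_sort_cat]. *)
Fixpoint stack_sort_rec (fuel : nat) (w : seq nat) : seq nat :=
  if fuel is f.+1 then
    if w is [::] then [::]
    else let n := max_entry w in
         let p := index n w in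
         stack_sort_rec f (take p w) ++ stack_sort_rec f (drop p.+1 w) ++ [:: n]
  else [::].

Definition stack_sort (w : seq nat) : seq nat := stack_sort_rec (size w) w.

Definition uniquely_sorted (w : seq nat) : Prop :=
  exists! v : seq nat, is_word v /\ stack_sort v = w.

Definition order_iso (u t : seq nat) : Prop :=
  size u = size t /\
  forall a b, a < size t -> b < size t ->
    (nth 0 u a < nth 0 u b) = (nth 0 t a < nth 0 t b).

Definition avoids (w t : seq nat) : Prop :=
  ~ exists u : seq nat, subseq u w /\ order_iso u t.

Definition U (n : nat) (t : seq nat) : set (seq nat) :=
  [set w | [/\ is_perm n w, uniquely_sorted w & avoids w t]].

Definition left_smaller (i : nat) (w : seq nat) : seq nat :=
  [seq x <- take (index i w) w | x < i].

Definition right_smaller (i : nat) (w : seq nat) : seq nat :=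
  [seq x <- drop (index i w).+1 w | x < i].

(* For x in a duplicate-free list A, x is the m-th smallest (resp. largest)
   element of A for m the number of y in A with y <= x (resp. x <= y). *)
Definition swu_at (i : nat) (w : seq nat) : seq nat :=
  [seq if i <= x then x
       else if x \in right_smaller i w then
         count (fun y => y <= x) (right_smaller i w)
       else i - count (fun y => x <= y) (left_smaller i w)
  | x <- w].

Definition swd_at (i : nat) (w : seq nat) : seq nat := rev (swu_at i (rev w)).

(* [foldr f w [:: 1; ...; n]] is f 1 (f 2 (... (f n w))), so the operator of
   index n = size w is applied first. *)
Definition swu (w : seq nat) : seq nat := foldr swu_at w (iota 1 (size w)).

Definition swd (w : seq nat) : seq nat := foldr swd_at w (iota 1 (size w)).

Lemma max_entry_cat (L R : seq nat) (n : nat) :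
  all (fun x => x < n) L -> all (fun x => x < n) R ->
  max_entry (L ++ n :: R) = n.
Proof.
move=> hL hR; have hmax : max_entry R <= n.
  elim: R hR => //= x R IH /andP[xn /IH Rn].
  by rewrite geq_max (ltnW xn).
elim: L hL => [_|x L IH /= /andP[xn /IH ->]] /=; first exact/maxn_idPl.
exact/maxn_idPr/ltnW.
Qed.

Lemma max_entry_mem (x : nat) (w : seq nat) : max_entry (x :: w) \in x :: w.
Proof.
elim: w x => [|y w IH] x; first by rewrite /= maxn0 inE eqxx.
rewrite [max_entry _]/= -/(max_entry (y :: w)) inE.
by case: (leqP x (max_entry (y :: w))) => _; rewrite ?eqxx // IH orbT.
Qed.

Lemma stack_sort_recE (f : nat) (w : seq nat) : 0 < size w ->
  stack_sort_rec f.+1 w =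
    stack_sort_rec f (take (index (max_entry w) w) w) ++
    stack_sort_rec f (drop (index (max_entry w) w).+1 w) ++ [:: max_entry w].
Proof. by case: w. Qed.

Lemma stack_sort_rec_fuel (f g : nat) (w : seq nat) :
  size w <= f -> size w <= g -> stack_sort_rec f w = stack_sort_rec g w.
Proof.
elim: f g w => [|f IH] [|g] [|x w] // wf wg.
rewrite !stack_sort_recE //; have := max_entry_mem x w; rewrite -index_mem.
move: (index _ _) => p pw; cbv zeta.
have ht : size (take p (x :: w)) <= size w by rewrite size_takel // ltnW.
have hd : size (drop p.+1 (x :: w)) <= size w by rewrite size_drop subSS leq_subr.
congr (_ ++ (_ ++ _)); apply: IH.
- exact: leq_trans ht wf.
- exact: leq_trans ht wg.
- exact: leq_trans hd wf.
- exact: leq_trans hd wg.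
Qed.

Lemma stack_sort_nil : stack_sort [::] = [::].
Proof. by []. Qed.

Lemma stack_sort_cat (L R : seq nat) (n : nat) :
  all (fun x => x < n) L -> all (fun x => x < n) R ->
  stack_sort (L ++ n :: R) = stack_sort L ++ stack_sort R ++ [:: n].
Proof.
move=> hL hR; have nL : n \notin L.
  by apply/negP => /(allP hL); rewrite ltnn.
have idx : index n (L ++ n :: R) = size L.
  by rewrite index_cat (negbTE nL) /= eqxx addn0.
have sz : size (L ++ n :: R) = (size L + size R).+1.
  by rewrite size_cat /= addnS.
rewrite {1}/stack_sort sz stack_sort_recE ?sz // max_entry_cat // idx.
rewrite take_size_cat // -(cat_rcons n L R) drop_size_cat ?size_rcons //.
congr (_ ++ (_ ++ _)); rewrite /stack_sort.
- by apply: stack_sort_rec_fuel; rewrite ?leq_addr.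
- by apply: stack_sort_rec_fuel; rewrite ?leq_addl.
Qed.

(* Main.v *)
(* A preimage of a word w under s is the in-order reading of a decreasing
   binary plane tree with postorder reading w, and a labelled tree is decreasing
   exactly when each node is the maximum of the factor of the postorder reading
   formed by its subtree.  So unique sortedness is invariant under relabellings
   that keep the positions of the maxima of all factors.  Each swu_i is such a
   relabelling; applying swu_n, ..., swu_i leaves no 132 pattern whose largest
   entry is at least i.  Symmetrically swd = rev o swu o rev reaches a
   231-avoiding permutation.  Finally a permutation avoiding 132 (or 231) is
   determined by the positions of the maxima of its factors, which makes swu
   and swd mutually inverse. *)

Require Import Defs.
From mathcomp Require Import all_boot.
From mathcomp Require Import boolp classical_sets functions.
From mathcomp Require Import zify.

Set Implicit Arguments.
Unset Strict Implicit.
Unset Printing Implicit Defensive.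

(** * Positions of maxima of factors *)

Definition range_max (w : seq nat) (a c b : nat) : Prop :=
  a <= b <= c /\ forall d, a <= d <= c -> nth 0 w d <= nth 0 w b.

(** Only the implication from [u] to [v] is required; distinct entries in [v] make it reversible.
    The bound on [c] keeps the default value of [nth] out of the factor. *)
Definition same_maxima (u v : seq nat) : Prop :=
  size u = size v /\
  forall a b c, c < size u -> range_max u a c b -> range_max v a c b.

Lemma range_max_exists (w : seq nat) (a c : nat) :
  a <= c -> exists b, range_max w a c b.
Proof.
elim: c => [|c IH] ac.
  by exists 0; split=> [|d ?]; [lia | have -> : d = 0 by lia].
case: (ltngtP a c.+1) ac => // [ac|->] _; last first.
  by exists c.+1; split=> [|d ?]; [lia | have -> : d = c.+1 by lia].
have [b [abc hb]] := IH ac.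
have [le|lt] := leqP (nth 0 w c.+1) (nth 0 w b).
  exists b; split=> [|d]; first lia.
  by have [->|ne] := eqVneq d c.+1 => // ?; apply: hb; lia.
exists c.+1; split=> [|d]; first lia.
have [->|ne] := eqVneq d c.+1 => // ?.
by apply: leq_trans (ltnW lt); apply: hb; lia.
Qed.

Lemma same_maxima_trans (v u w : seq nat) :
  same_maxima u v -> same_maxima v w -> same_maxima u w.
Proof.
move=> [suv uv] [svw vw]; split=> [|a b c cu /uv h]; first by rewrite suv.
by apply: vw; rewrite -?suv //; apply: h.
Qed.

(** Every factor of [u] has a maximum, whose position is carried over to [v]; as the entries of [v]
    are distinct, it is the only candidate there. *)
Lemma same_maxima_sym (u v : seq nat) :
  uniq v -> same_maxima u v -> same_maxima v u.
Proof.
move=> uv [suv h]; split=> // a b c cv [abc hb].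
have [|b' mb'] := @range_max_exists u a c; first lia.
have [abc' hb'] : range_max v a c b' by apply: h mb'; rewrite suv.
suff -> : b = b' by [].
have [bv b'v] : b < size v /\ b' < size v by lia.
by apply/eqP; rewrite -(nth_uniq 0 bv b'v uv) eqn_leq hb ?hb'.
Qed.

Lemma same_maxima_rev (u v : seq nat) :
  same_maxima u v -> same_maxima (rev u) (rev v).
Proof.
move=> [suv h]; split=> [|a b c]; rewrite !size_rev // => cu [abc hb].
have nthr w d : size w = size u -> d < size u ->
    nth 0 (rev w) d = nth 0 w (size u - d.+1).
  by move=> sw du; rewrite nth_rev sw.
have [|_ hv] := h (size u - c.+1) (size u - b.+1) (size u - a.+1) ltac:(lia).
  split=> [|d ad]; first lia.
  have := hb (size u - d.+1); rewrite !nthr; try lia.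
  rewrite (_ : size u - (size u - d.+1).+1 = d); last lia.
  by apply; lia.
split=> // d ad; rewrite !nthr; try lia.
by apply: hv; lia.
Qed.

Lemma same_maxima_catl (u1 u2 v1 v2 : seq nat) : size u1 = size v1 ->
  same_maxima (u1 ++ u2) (v1 ++ v2) -> same_maxima u1 v1.
Proof.
move=> s1 [_ h]; split=> // a b c cu [abc hb].
have [||_ hv] := h a b c; first by rewrite size_cat; lia.
  by split=> // d ad; rewrite !nth_cat !ifT; [exact: hb|lia|lia].
split=> // d ad; have := hv d ad.
by rewrite !nth_cat !ifT //; lia.
Qed.

Lemma same_maxima_catr (u1 u2 v1 v2 : seq nat) : size u1 = size v1 ->
  same_maxima (u1 ++ u2) (v1 ++ v2) -> same_maxima u2 v2.
Proof.
move=> s1 [s h]; have s2 : size u2 = size v2.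
  by move: s; rewrite !size_cat s1 => /addnI.
split=> // a b c cu [abc hb].
have nthc (x y : seq nat) d : size x = size u1 ->
    nth 0 (x ++ y) (size u1 + d) = nth 0 y d.
  by move=> sx; rewrite nth_cat sx ifF ?addKn //; lia.
have [||_ hv] := h (size u1 + a) (size u1 + b) (size u1 + c).
- by rewrite size_cat; lia.
- split=> [|d ad]; first lia.
  rewrite (_ : d = size u1 + (d - size u1)); last lia.
  by rewrite !nthc //; apply: hb; lia.
split=> // d ad; have := hv (size u1 + d).
by rewrite !nthc //; apply; lia.
Qed.

(** * Stack-sorting under relabelling *)

Lemma stack_sort_ind (P : seq nat -> Prop) :
  P [::] ->
  (forall L m R, all (fun x => x < m) L -> all (fun x => x < m) R ->
     P L -> P R -> P (L ++ m :: R)) ->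
  forall p : seq nat, uniq p -> P p.
Proof.
move=> P0 PS p; have [n] := ubnP (size p).
elim: n p => // n IH [|x p] // szp up.
move: (x :: p) szp up (max_entry_mem x p) => w szp up mp.
have le y : y \in w -> y <= max_entry w.
  elim: (w) => //= z s IHs; rewrite inE leq_max => /orP[/eqP->|/IHs->].
    by rewrite leqnn.
  by rewrite orbT.
move: (max_entry w) mp szp up le => m mp; case/splitPr: mp => L R.
move=> szp; rewrite cat_uniq /= => /and3P[uL].
rewrite negb_or => /andP[nL _] /andP[nR uR] le.
move: szp; rewrite size_cat /= => szp.
(* Distinctness makes the bound by the maximum strict, as [stack_sort_cat] requires. *)
have lt (s : seq nat) : {subset s <= L ++ m :: R} ->
    m \notin s -> all (fun x => x < m) s.
  move=> sub ns; apply/allP => y ys; rewrite ltn_neqAle le ?sub // andbT.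
  by apply: contraNneq ns => <-.
apply: PS; [apply: lt | apply: lt | apply: IH | apply: IH] => //.
- by move=> y; rewrite mem_cat => ->.
- by move=> y; rewrite mem_cat inE => ->; rewrite !orbT.
- by lia.
- by lia.
Qed.

Lemma perm_stack_sort (p : seq nat) : uniq p -> perm_eq (stack_sort p) p.
Proof.
elim/stack_sort_ind=> // L m R hL hR pL pR.
rewrite stack_sort_cat // perm_cat // cats1 perm_rcons perm_cons //.
Qed.

(** This is the case of the factor equal to the whole word, with its maximum in last position. *)
Lemma same_maxima_last (u v : seq nat) (m m' : nat) :
  same_maxima (rcons u m) (rcons v m') ->
  all (fun x => x <= m) u -> all (fun x => x <= m') v.
Proof.
move=> [/eqP]; rewrite !size_rcons eqSS => /eqP suv h hu.
have [||_ hv] := h 0 (size u) (size u); first by rewrite leqnn.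
  split=> [|d du]; first by rewrite leqnn.
  rewrite !nth_rcons ltnn eqxx; have [lt|gt|_] := ltngtP d (size u) => //.
  by apply: (allP hu); rewrite mem_nth.
apply/(all_nthP 0) => d dv; have := hv d.
rewrite !nth_rcons suv dv ltnn eqxx => le; apply: le; exact: ltnW.
Qed.

(** The sorted images of [L] and [R] are factors of [stack_sort p], so they inherit the hypothesis.
    The whole word is a factor too, so [f m] is still the largest letter and the relabelled word
    splits at the same place. *)
Lemma stack_sort_map (f : nat -> nat) (p : seq nat) :
  uniq p -> uniq (map f p) ->
  same_maxima (stack_sort p) (map f (stack_sort p)) ->
  stack_sort (map f p) = map f (stack_sort p).
Proof.
move=> up; elim/stack_sort_ind: p / up => // L m R hL hR IHL IHR.
move=> ufp; have upp := map_uniq ufp; move: ufp.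
rewrite stack_sort_cat // !map_cat /= => ufp.
have [uL uR] : uniq L /\ uniq R.
  by move: upp; rewrite cat_uniq /= => /and3P[? _ /andP[_ ?]].
have [ufL ufR] : uniq (map f L) /\ uniq (map f R).
  by move: ufp; rewrite cat_uniq /= => /and3P[? _ /andP[_ ?]].
have [permL permR] := (perm_stack_sort uL, perm_stack_sort uR).
move=> sm.
have smL := same_maxima_catl (esym (size_map _ _)) sm.
have smR := same_maxima_catl (esym (size_map _ _))
              (same_maxima_catr (esym (size_map _ _)) sm).
have memp (s : seq nat) : perm_eq (stack_sort s) s ->
    all (fun x => x < m) s -> all (fun x => x <= m) (stack_sort s).
  move=> ps hs; rewrite (perm_all _ ps).
  by apply: sub_all hs => x; apply: ltnW.
(* Regroup so that [m] is the last letter of the sorted word. *)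
have smr := sm; rewrite !catA !cats1 in smr; move: (same_maxima_last smr).
rewrite all_cat !memp // => /(_ isT); rewrite all_cat => /andP[leL leR].
have lt (s : seq nat) : perm_eq (stack_sort s) s ->
    f m \notin map f s -> all (fun x => x <= f m) (map f (stack_sort s)) ->
    all (fun x => x < f m) (map f s).
  move=> ps nm; rewrite (perm_all _ (perm_map f ps)) => /allP le.
  apply/allP => x xs; rewrite ltn_neqAle le // andbT.
  by apply: contraNneq nm => <-.
move: ufp; rewrite cat_uniq /= negb_or => /and3P[_ /andP[nL _] /andP[nR _]].
by rewrite stack_sort_cat; [rewrite IHL // IHR | exact: lt | exact: lt].
Qed.

(** Replacing the letter in position [d] of [u] by the letter in position [d] of [v] turns preimages
    of [u] into preimages of [v], and the inverse relabelling goes back. *)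
Lemma uniquely_sorted_same_maxima (u v : seq nat) :
  is_word u -> is_word v -> same_maxima u v ->
  uniquely_sorted u -> uniquely_sorted v.
Proof.
have mapE (x y : seq nat) : uniq x -> size x = size y ->
    map (fun z => nth 0 y (index z x)) x = y.
  move=> ux sxy; apply: (@eq_from_nth _ 0); rewrite ?size_map // => i ix.
  by rewrite (nth_map 0) // index_uniq.
have preimage (x y p : seq nat) : is_word x -> is_word y -> same_maxima x y ->
    is_word p -> stack_sort p = x ->
    let q := map (fun z => nth 0 y (index z x)) p in
    is_word q /\ stack_sort q = y.
  move=> /andP[ux px] /andP[uy py] sm /andP[up pp] sp; set f := fun z => _.
  have permx : perm_eq x p by rewrite -sp perm_stack_sort.
  have fx : map f x = y by apply: mapE => //; case: sm.
  have permy : perm_eq y (map f p) by rewrite -fx perm_map.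
  split; first by rewrite /is_word -(perm_uniq permy) -(perm_all _ permy) uy.
  by rewrite stack_sort_map ?sp ?fx // -(perm_uniq permy).
move=> wu wv sm [p [[wp sp] pmin]].
have [/andP[uu _] /andP[uv _]] := (wu, wv).
have smr := same_maxima_sym uv sm.
exists (map (fun z => nth 0 v (index z u)) p); split.
  exact: preimage wp sp.
(* A preimage [q] of [v], relabelled back, is a preimage of [u] and so equals [p]; it remains to see
   that the two relabellings cancel on [q]. *)
move=> q [wq sq]; have [wq' sq'] := preimage _ _ _ wv wu smr wq sq.
rewrite (pmin _ (conj wq' sq')) -map_comp -[RHS]map_id.
apply/eq_in_map => z zq /=.
have zv : z \in v by rewrite -sq (perm_mem (perm_stack_sort _)) //; case/andP: wq.
by rewrite index_uniq ?nth_index // (proj1 sm) index_mem.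
Qed.

(** * Permutations and counting of smaller entries *)

Lemma is_perm_facts (n : nat) (w : seq nat) : is_perm n w ->
  [/\ uniq w, size w = n & w =i iota 1 n].
Proof.
move=> pw; split; last exact: perm_mem.
  by rewrite (perm_uniq pw) iota_uniq.
by rewrite (perm_size pw) size_iota.
Qed.

Lemma is_perm_nth (n a : nat) (w : seq nat) : is_perm n w -> a < n ->
  0 < nth 0 w a <= n.
Proof.
move=> pw an; have [_ sw mw] := is_perm_facts pw.
have := mem_nth 0 (_ : a < size w); rewrite sw mw mem_iota add1n ltnS; exact.
Qed.

Lemma is_perm_word (n : nat) (w : seq nat) : is_perm n w -> is_word w.
Proof.
move=> pw; rewrite /is_word; have [-> _ mw] := is_perm_facts pw.
by apply/allP => x; rewrite mw mem_iota /=; lia.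
Qed.

Lemma count_lt_perm (n x : nat) (w : seq nat) : is_perm n w ->
  x \in w -> count (fun y => y < x) w = x.-1.
Proof.
move=> pw; rewrite (perm_mem pw) (permP pw) mem_iota => /andP[x0 xn].
(* Cut the interval from 1 to [n] just before [x]: all of the first block is counted and none of the
   second. *)
rewrite (_ : n = x.-1 + (n - x.-1)); last lia.
rewrite iotaD count_cat.
rewrite (_ : count _ (iota 1 _) = x.-1); last first.
  rewrite -[RHS](size_iota 1); apply/eqP; rewrite -all_count.
  by apply/allP => y; rewrite mem_iota; lia.
rewrite (_ : count _ _ = 0) ?addn0 //; apply/eqP.
rewrite -leqn0 leqNgt -has_count; apply/hasPn => y.
by rewrite mem_iota -leqNgt; lia.
Qed.

Lemma count_strict (T : eqType) (P Q : pred T) (s : seq T) (x : T) :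
  (forall y, y \in s -> P y -> Q y) -> x \in s -> Q x -> ~~ P x ->
  count P s < count Q s.
Proof.
(* Adding the membership bit gives a statement that also holds for lists without [x], so induction
   applies. *)
move=> PQ xs Qx nPx; suff: count P s + (x \in s) <= count Q s.
  by rewrite xs addn1.
elim: s PQ {xs} => //= y s IH PQ.
have {}IH : count P s + (x \in s) <= count Q s.
  by apply: IH => z zs; apply: PQ; rewrite inE zs orbT.
rewrite inE; have [<-|_] /= := eqVneq x y.
  by rewrite (negPf nPx) Qx; lia.
have : P y <= Q y by case: (P y) (PQ y (mem_head _ _)) => // ->.
by lia.
Qed.

(** * A single sliding operator *)

Section SwuAt.

Variables (n i : nat) (w : seq nat).
Hypotheses (pw : is_perm n w) (i_gt0 : 0 < i) (i_le : i <= n).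

Let p := index i w.
Let v := swu_at i w.

Let uw : uniq w. Proof. by case: (is_perm_facts pw). Qed.
Let sw : size w = n. Proof. by case: (is_perm_facts pw). Qed.
Let iw : i \in w.
Proof. by case: (is_perm_facts pw) => _ _ ->; rewrite mem_iota; lia. Qed.
Let p_lt : p < n. Proof. by rewrite -sw index_mem. Qed.
Let wp : nth 0 w p = i. Proof. exact: nth_index. Qed.

Lemma size_swu_at : size v = n.
Proof. by rewrite size_map. Qed.

Lemma nth_left_smaller a : a < n ->
  (nth 0 w a \in left_smaller i w) = (nth 0 w a < i) && (a < p).
Proof.
move=> an; rewrite mem_filter in_take ?mem_nth ?sw //.
by rewrite index_uniq ?sw.
Qed.

Lemma nth_right_smaller a : a < n ->
  (nth 0 w a \in right_smaller i w) = (nth 0 w a < i) && (p < a).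
Proof.
move=> an; rewrite mem_filter; congr (_ && _).
have an' : a < size w by rewrite sw.
have := uw; rewrite -{1}(cat_take_drop p.+1 w) cat_uniq => /and3P[_ /hasPn nd _].
have mw := mem_nth 0 an'; have := in_take p.+1 mw; rewrite index_uniq // ltnS => it.
apply/idP/idP => [/nd|pa]; first by rewrite /= it -ltnNge.
by move: mw; rewrite -{2}(cat_take_drop p.+1 w) mem_cat it leqNgt pa.
Qed.

(** Consequently the labels given on the right of [i], which run from 1 to the number of smaller
    entries there, lie just below those given on the left, which end at [i - 1]. *)
Lemma size_left_right : size (left_smaller i w) + size (right_smaller i w) = i.-1.
Proof.
rewrite -(count_lt_perm pw iw) -[X in _ = count _ X](cat_take_drop p.+1 w).
rewrite (take_nth 0) ?sw // wp -cats1 !count_cat /= ltnn.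
by rewrite !size_filter /= !addn0.
Qed.

Lemma nth_swu_at_ge a : a < n -> i <= nth 0 w a -> nth 0 v a = nth 0 w a.
Proof. by move=> an le; rewrite (nth_map 0) ?sw // le. Qed.

Lemma nth_swu_at_right a : a < n -> nth 0 w a < i -> p < a ->
  nth 0 v a = count (fun y => y <= nth 0 w a) (right_smaller i w).
Proof.
by move=> an lt pa; rewrite (nth_map 0) ?sw // leqNgt nth_right_smaller // lt pa.
Qed.

Lemma nth_swu_at_left a : a < n -> nth 0 w a < i -> a < p ->
  nth 0 v a = i - count (fun y => nth 0 w a <= y) (left_smaller i w).
Proof.
move=> an lt ap; rewrite (nth_map 0) ?sw // leqNgt nth_right_smaller // lt /=.
by rewrite ltnNge (ltnW ap).
Qed.

Lemma swu_at_lt a : a < n -> nth 0 w a < i -> 0 < nth 0 v a < i.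
Proof.
move=> an lt; have slr := size_left_right.
have [ap|pa|e] := ltngtP a p; last by move: lt; rewrite e wp ltnn.
- rewrite nth_swu_at_left //.
  have := count_size (fun y => nth 0 w a <= y) (left_smaller i w).
  have : 0 < count (fun y => nth 0 w a <= y) (left_smaller i w).
    rewrite -has_count; apply/hasP; exists (nth 0 w a) => //.
    by rewrite nth_left_smaller ?lt.
  by lia.
- rewrite nth_swu_at_right //.
  have := count_size (fun y => y <= nth 0 w a) (right_smaller i w).
  have : 0 < count (fun y => y <= nth 0 w a) (right_smaller i w).
    rewrite -has_count; apply/hasP; exists (nth 0 w a) => //.
    by rewrite nth_right_smaller ?lt.
  by lia.
Qed.

Lemma swu_at_cross a b : b < n -> nth 0 w a < i -> nth 0 w b < i ->
  a < p -> p < b -> nth 0 v b < nth 0 v a.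
Proof.
move=> bn la lb ap pb; have an : a < n by exact: ltn_trans p_lt.
rewrite (nth_swu_at_left an) // (nth_swu_at_right bn) //.
have := count_size (fun y => nth 0 w a <= y) (left_smaller i w).
have := count_size (fun y => y <= nth 0 w b) (right_smaller i w).
by have slr := size_left_right; lia.
Qed.

Lemma swu_at_mono a b : a < n -> b < n -> nth 0 w a < nth 0 w b ->
  nth 0 w b < i -> (a < p) = (b < p) -> nth 0 v a < nth 0 v b.
Proof.
move=> an bn lab lb; have la := ltn_trans lab lb.
have ap : a != p by apply: contraTneq la => ->; rewrite wp ltnn.
have bp : b != p by apply: contraTneq lb => ->; rewrite wp ltnn.
have [lap|lap] := ltnP a p => /esym lbp.
- rewrite !nth_swu_at_left //.
  have ma : nth 0 w a \in left_smaller i w by rewrite nth_left_smaller ?la.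
  (* Labels on the left are subtracted from [i], so the smaller entry must have the larger count; it
     is the extra element counted. *)
  have : count (fun y => nth 0 w b <= y) (left_smaller i w) <
         count (fun y => nth 0 w a <= y) (left_smaller i w).
    apply: (count_strict (x := nth 0 w a)) => //; last by rewrite -ltnNge.
    by move=> y _; lia.
  have := count_size (fun y => nth 0 w a <= y) (left_smaller i w).
  by have slr := size_left_right; lia.
- have [pa pb] : p < a /\ p < b by lia.
  rewrite !nth_swu_at_right //; apply: (count_strict (x := nth 0 w b)) => //.
  + by move=> y _; lia.
  + by rewrite nth_right_smaller ?lb.
  + by rewrite -ltnNge.
Qed.

Lemma swu_at_pos a : a < n -> 0 < nth 0 v a <= n.
Proof.
move=> an; have [le|lt] := leqP i (nth 0 w a); last first.
  by have := swu_at_lt an lt; lia.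
by rewrite nth_swu_at_ge // is_perm_nth.
Qed.

(** Entries at least [i] are fixed and the others stay below [i]. Two entries below [i] are
    separated by [swu_at_mono] when on the same side of [i], and by [swu_at_cross] otherwise. *)
Lemma swu_at_inj a b : a < n -> b < n -> nth 0 v a = nth 0 v b -> a = b.
Proof.
move=> an bn e; apply/eqP; rewrite -(nth_uniq 0 _ _ uw) ?sw //.
have [gea|lta] := leqP i (nth 0 w a); have [geb|ltb] := leqP i (nth 0 w b).
- by move: e; rewrite (nth_swu_at_ge an) // (nth_swu_at_ge bn) // => ->.
- by have := swu_at_lt bn ltb; rewrite -e nth_swu_at_ge //; lia.
- by have := swu_at_lt an lta; rewrite e nth_swu_at_ge //; lia.
have ap : a != p by apply: contraTneq lta => ->; rewrite wp ltnn.
have bp : b != p by apply: contraTneq ltb => ->; rewrite wp ltnn.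
have [ab|ab] := eqVneq (a < p) (b < p).
  case: (ltngtP (nth 0 w a) (nth 0 w b)) => // lt.
    by have := swu_at_mono an bn lt ltb ab; rewrite e ltnn.
  by have := swu_at_mono bn an lt lta (esym ab); rewrite e ltnn.
have [lap|lap] := ltnP a p.
  have pb : p < b by move: ab; rewrite lap; lia.
  by have := swu_at_cross bn lta ltb lap pb; rewrite e ltnn.
have lbp : b < p by lia.
have pa : p < a by lia.
by have := swu_at_cross an ltb lta lbp pa; rewrite e ltnn.
Qed.

Lemma is_perm_swu_at : is_perm n v.
Proof.
have uv : uniq v.
  by apply/(uniqP 0) => a b; rewrite !inE size_swu_at; exact: swu_at_inj.
have sub : {subset v <= iota 1 n}.
  move=> x /(nthP 0)[a]; rewrite size_swu_at => an <-.
  by rewrite mem_iota add1n ltnS; apply: swu_at_pos.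
have [_ mv] := uniq_min_size uv sub ltac:(by rewrite size_iota size_swu_at).
exact: uniq_perm (iota_uniq _ _) mv.
Qed.

(* If the maximum of a factor is less than [i], the factor lies on one side of
   [i], where [swu_at i] keeps the relative order. *)
Lemma same_maxima_swu_at : same_maxima w v.
Proof.
split=> [|a b c]; rewrite ?size_map // sw => cn [abc hb]; split=> // d ad.
have [bn dn] : b < n /\ d < n by lia.
have le := hb d ad; have [geb|ltb] := leqP i (nth 0 w b).
  rewrite (nth_swu_at_ge bn) //; have [ged|ltd] := leqP i (nth 0 w d).
    by rewrite nth_swu_at_ge.
  by have := swu_at_lt dn ltd; lia.
have [->//|ne] := eqVneq d b.
have nap : ~ a <= p <= c by move/hb; rewrite wp; lia.
apply: ltnW; apply: swu_at_mono => //; last lia.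
by rewrite ltn_neqAle le nth_uniq ?sw // ne.
Qed.

End SwuAt.

(** * Removal of 132 patterns, by decreasing largest entry *)

Definition avoids132_above (i : nat) (w : seq nat) : Prop :=
  forall a b c, a < b -> b < c -> c < size w -> i <= nth 0 w b ->
    nth 0 w a < nth 0 w b -> nth 0 w c < nth 0 w b -> nth 0 w c < nth 0 w a.

(** Entries at least [i] do not move, so the peak of a possible pattern is fixed. If the peak is [i]
    itself, smaller entries on its two sides are ordered by [swu_at_cross]. If it is larger, [w] has
    the right order already, and [swu_at i] keeps it. *)
Lemma swu_at_avoids (n i : nat) (w : seq nat) :
  is_perm n w -> 0 < i -> i <= n ->
  avoids132_above i.+1 w -> avoids132_above i (swu_at i w).
Proof.
move=> pw i0 ilen av a b c ab bc cn.
have [uw sw _] := is_perm_facts pw.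
have cn' : c < n by move: cn; rewrite (size_swu_at i pw).
have [an bn] : a < n /\ b < n by lia.
have ip : i \in w by rewrite (perm_mem pw) mem_iota; lia.
have wp := nth_index 0 ip; have := index_mem i w; rewrite ip sw => pn.
set p := index i w in wp pn.
have lt := swu_at_lt pw i0 ilen.
have [ltb|geb] := ltnP (nth 0 w b) i; first by have := lt b bn ltb; lia.
rewrite (nth_swu_at_ge pw bn geb) => _.
have [lta|gea] := ltnP (nth 0 w a) i; last first.
  rewrite (nth_swu_at_ge pw an gea) => wab.
  have [ltc|gec] := ltnP (nth 0 w c) i; first by have := lt c cn' ltc; lia.
  rewrite (nth_swu_at_ge pw cn' gec) => wcb.
  by apply: (av a b c); rewrite ?sw //; lia.
(* Here the first entry is below [i] and the last is not, so the peak exceeds [i] and [w] itself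
   would contain a forbidden pattern. *)
have [ltc|gec] := ltnP (nth 0 w c) i; last first.
  rewrite (nth_swu_at_ge pw cn' gec) => _ wcb.
  by have := av a b c ab bc; rewrite sw; lia.
move=> _ _.
have ap : a != p by apply: contraTneq lta => ->; rewrite wp ltnn.
have cp : c != p by apply: contraTneq ltc => ->; rewrite wp ltnn.
have [e|ne] := eqVneq b p.
  by apply: (swu_at_cross pw) => //; rewrite -/p -e.
have nib : nth 0 w b != i by rewrite -wp nth_uniq ?sw //; lia.
have lca : nth 0 w c < nth 0 w a by apply: (av a b c); rewrite ?sw //; lia.
(* As [a < c], lying on different sides means that [a] is left of [i] and [c] is right of it. *)
have [e|ac] := eqVneq (c < p) (a < p); first exact: (swu_at_mono pw).
by apply: (swu_at_cross pw) => //; rewrite -/p; lia.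
Qed.

Lemma swu_spec (n : nat) (w : seq nat) : is_perm n w ->
  [/\ is_perm n (swu w), same_maxima w (swu w) & avoids132_above 1 (swu w)].
Proof.
move=> pw; have [uw sw _] := is_perm_facts pw; rewrite /swu sw.
(* Invariant once the operators of index [n] down to [j] have been applied. *)
suff fold m j : j + m = n.+1 -> 0 < j ->
    let x := foldr swu_at w (iota j m) in
    [/\ is_perm n x, same_maxima w x & avoids132_above j x].
  by apply: fold; rewrite ?add1n.
elim: m j => [|m IH] j jm j0 /=.
  (* Initially [j] is [n + 1], and no entry is that large. *)
  split=> // a b c ab bc cw; have bn : b < n by lia.
  by have := is_perm_nth pw bn; lia.
have [|//|pv sm av] := IH j.+1; first lia.
have jn : j <= n by lia.
split; first exact: is_perm_swu_at.
  exact: same_maxima_trans sm (same_maxima_swu_at pv j0 jn).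
exact: swu_at_avoids pv _ _ av.
Qed.

(** * Pattern avoidance in terms of positions *)

Lemma subseq_nthP (u w : seq nat) :
  reflect (exists2 s, sorted ltn s && all (gtn (size w)) s & u = map (nth 0 w) s)
          (subseq u w).
Proof.
have wE : map (nth 0 w) (iota 0 (size w)) = w by rewrite map_nth_iota0 ?take_size.
apply: (iffP idP) => [/subseqP[m _ ->]|[s /andP[ss sw] ->]].
  exists (mask m (iota 0 (size w))); last by rewrite map_mask wE.
  rewrite (subseq_sorted ltn_trans (mask_subseq _ _)) ?iota_ltn_sorted //=.
  by apply/allP => x /mem_mask; rewrite mem_iota.
rewrite -[X in subseq _ X]wE; apply: map_subseq.
(* A strictly increasing list of positions is a filtered interval, hence a subsequence of it. *)
have -> : s = [seq x <- iota 0 (size w) | x \in s].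
  apply: (irr_sorted_eq ltn_trans ltnn) => //.
    by apply: sorted_filter; [exact: ltn_trans | exact: iota_ltn_sorted].
  move=> x; rewrite mem_filter mem_iota /=.
  by case xs: (x \in s) => //=; symmetry; exact: (allP sw).
exact: filter_subseq.
Qed.

Lemma avoidsP (w : seq nat) (x y z : nat) : avoids w [:: x; y; z] <->
  forall a b c, a < b -> b < c -> c < size w ->
    ~ order_iso [:: nth 0 w a; nth 0 w b; nth 0 w c] [:: x; y; z].
Proof.
split=> [av a b c ab bc cw oi|av [u [/subseq_nthP[s sP ->] oi]]].
  apply: av; eexists; split; last exact: oi.
  apply/subseq_nthP; exists [:: a; b; c] => //=; rewrite ab bc cw /=; lia.
have := oi.1; rewrite size_map.
case: s sP oi => [|a [|b [|c [|d s]]]] //= sP oi _.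
by apply: (av a b c) oi; lia.
Qed.

Lemma avoids132 (w : seq nat) :
  uniq w -> avoids w [:: 1; 3; 2] <-> avoids132_above 1 w.
Proof.
move=> uw; rewrite avoidsP; split=> av a b c ab bc cw.
  move=> _ wab wcb; have [//|le] := ltnP (nth 0 w c) (nth 0 w a).
  have aw : a < size w by lia.
  have ne : nth 0 w a != nth 0 w c by rewrite nth_uniq //; lia.
  case: (av a b c ab bc cw); split=> // x y.
  by do 3?[case: x => [|x] //]; do 3?[case: y => [|y] //] => _ _ /=; lia.
case=> _ oi; have := oi 0 1 isT isT; have := oi 2 1 isT isT.
have := oi 0 2 isT isT => /= h1 h2 h3.
have := av a b c ab bc cw; rewrite h2 h3 => /(_ ltac:(lia) isT isT).
by rewrite ltnNge ltnW // h1.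
Qed.

Lemma avoids231 (w : seq nat) :
  uniq w -> avoids w [:: 2; 3; 1] <-> avoids132_above 1 (rev w).
Proof.
move=> uw; rewrite -avoids132 ?rev_uniq // !avoidsP size_rev.
split=> av a b c ab bc cw; rewrite ?nth_rev; try lia.
  (* Reversal reflects the three positions in the word, and index [x] of the pattern becomes
     [2 - x], which exchanges 231 and 132. *)
  move=> [_ oi]; apply: (av (size w - c.+1) (size w - b.+1) (size w - a.+1)); try lia.
  split=> // x y x3 y3; have := oi (2 - x) (2 - y).
  by move: x3 y3; do 3?[case: x => [|x] //]; do 3?[case: y => [|y] //] => _ _ /= ->.
move=> [_ oi]; apply: (av (size w - c.+1) (size w - b.+1) (size w - a.+1)); try lia.
rewrite !nth_rev; try lia.
rewrite !(_ : forall m, m < size w -> size w - (size w - m.+1).+1 = m); try lia.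
split=> // x y x3 y3; have := oi (2 - x) (2 - y).
by move: x3 y3; do 3?[case: x => [|x] //]; do 3?[case: y => [|y] //] => _ _ /= ->.
Qed.

(** * Rigidity of 132-avoiding permutations *)

Lemma same_maxima_avoids132_lt (u v : seq nat) (a c : nat) :
  uniq u -> uniq v -> same_maxima u v ->
  avoids132_above 1 u -> avoids132_above 1 v ->
  a < c -> c < size u -> (nth 0 u a < nth 0 u c) = (nth 0 v a < nth 0 v c).
Proof.
move=> uu uv sm avu avv ac cu; have [suv h] := sm.
have [b mu] := range_max_exists u (ltnW ac); have mv := h a b c cu mu.
(* Let [b] be the position of the maximum between [a] and [c]. If [b] is strictly inside, avoidance
   of 132 forces the entry at [c] below the entry at [a]; so the comparison depends only on whether
   [b] is [c], and [b] is common to both words. *)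
suff lt w : uniq w -> size w = size u -> avoids132_above 1 w ->
    range_max w a c b -> (nth 0 w a < nth 0 w c) = (b == c) by rewrite !lt.
move=> uw sw avw [abc hb].
have ne d e : d < e -> e <= c -> nth 0 w d != nth 0 w e.
  by move=> de ec; rewrite nth_uniq ?sw //; lia.
have [ebc | bc] := eqVneq b c.
  by have := hb a; have := ne a c; rewrite ebc; lia.
have [eab | ab] := eqVneq b a.
  by have := hb c; rewrite eab; lia.
have [lab lbc] : a < b /\ b < c by lia.
have := avw a b c lab lbc; rewrite sw => /(_ cu).
have := hb a; have := hb c; have := ne a b; have := ne b c; lia.
Qed.

(** An entry of a permutation is one more than the number of smaller entries, so all pairwise
    comparisons together determine the word. *)
Lemma same_maxima_avoids132_inj (n : nat) (u v : seq nat) :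
  is_perm n u -> is_perm n v -> same_maxima u v ->
  avoids132_above 1 u -> avoids132_above 1 v -> u = v.
Proof.
move=> pu pv sm avu avv.
have [[uu su _] [uv sv _]] := (is_perm_facts pu, is_perm_facts pv).
apply: (@eq_from_nth _ 0) => [|a]; rewrite su ?sv // => an.
have cmp d : d < n -> (nth 0 u d < nth 0 u a) = (nth 0 v d < nth 0 v a).
  move=> dn; have [lt|gt|->] := ltngtP d a; last by rewrite !ltnn.
    by apply: same_maxima_avoids132_lt => //; rewrite su.
  have := same_maxima_avoids132_lt uu uv sm avu avv gt; rewrite su => /(_ dn).
  have neu : nth 0 u a != nth 0 u d by rewrite nth_uniq ?su //; lia.
  have nev : nth 0 v a != nth 0 v d by rewrite nth_uniq ?sv //; lia.
  by lia.
have countE w : is_perm n w ->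
    (nth 0 w a).-1 = count (fun d => nth 0 w d < nth 0 w a) (iota 0 n).
  move=> pw; have [_ sw _] := is_perm_facts pw.
  rewrite -(count_lt_perm pw) ?mem_nth ?sw //.
  rewrite -[X in count _ X](take_size w) -(map_nth_iota0 0 (leqnn _)).
  by rewrite count_map sw.
have := countE u pu; rewrite (@eq_in_count _ _ (fun d => nth 0 v d < nth 0 v a)).
  rewrite -countE //.
  by have := is_perm_nth pu an; have := is_perm_nth pv an; lia.
by move=> d; rewrite mem_iota => /andP[_ dn]; apply: cmp.
Qed.

(** * The map [swd] and mutual inverses *)

Lemma swd_rev (w : seq nat) : swd w = rev (swu (rev w)).
Proof.
rewrite /swd /swu size_rev; elim: (iota 1 _) => [|i s IH] /=.
  by rewrite revK.
(* The reversal that ends one [swd_at] cancels the one that begins the next. *)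
by rewrite IH /swd_at revK.
Qed.

Lemma is_perm_rev (n : nat) (w : seq nat) : is_perm n (rev w) = is_perm n w.
Proof. by rewrite /is_perm perm_rev. Qed.

Lemma swu_U (n : nat) (w : seq nat) :
  U n [:: 2; 3; 1] w -> U n [:: 1; 3; 2] (swu w).
Proof.
case=> pw usw _; have [pv sm av] := swu_spec pw; split=> //.
  exact: uniquely_sorted_same_maxima (is_perm_word pw) (is_perm_word pv) sm usw.
by apply/avoids132; case: (is_perm_facts pv).
Qed.

Lemma swd_U (n : nat) (w : seq nat) :
  U n [:: 1; 3; 2] w -> U n [:: 2; 3; 1] (swd w).
Proof.
case=> pw usw _; have pr : is_perm n (rev w) by rewrite is_perm_rev.
have [pv sm av] := swu_spec pr; rewrite swd_rev.
have pv' : is_perm n (rev (swu (rev w))) by rewrite is_perm_rev.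
split=> //.
  apply: uniquely_sorted_same_maxima (is_perm_word pw) (is_perm_word pv') _ usw.
  by have := same_maxima_rev sm; rewrite revK.
by apply/avoids231; rewrite ?revK //; case: (is_perm_facts pv').
Qed.

(** Both [w] and [swd (swu w)] avoid 231 and have their factor maxima in the same positions, so
    rigidity applies to their reversals. *)
Lemma swuK (n : nat) (w : seq nat) : is_perm n w ->
  avoids132_above 1 (rev w) -> swd (swu w) = w.
Proof.
move=> pw av; have [pv sm _] := swu_spec pw.
have prv : is_perm n (rev (swu w)) by rewrite is_perm_rev.
have [px smx avx] := swu_spec prv.
rewrite swd_rev -[RHS]revK; congr rev.
apply: (same_maxima_avoids132_inj px _ _ avx av); first by rewrite is_perm_rev.
apply: same_maxima_sym; first by case: (is_perm_facts px).
exact: same_maxima_trans (same_maxima_rev sm) smx.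
Qed.

(** Conjugation by [rev] exchanges [swu] and [swd], which reduces this to [swuK] for [rev w]. *)
Lemma swdK (n : nat) (w : seq nat) : is_perm n w ->
  avoids132_above 1 w -> swu (swd w) = w.
Proof.
move=> pw av; apply: (can_inj revK).
by rewrite [in LHS]swd_rev -swd_rev (@swuK n) ?is_perm_rev ?revK.
Qed.

Theorem theorem6p1 (k : nat) :
  [/\ set_bij (U (2 * k + 1) [:: 2; 3; 1]) (U (2 * k + 1) [:: 1; 3; 2]) swu,
      set_bij (U (2 * k + 1) [:: 1; 3; 2]) (U (2 * k + 1) [:: 2; 3; 1]) swd,
      forall w : seq nat, U (2 * k + 1) [:: 2; 3; 1] w -> swd (swu w) = w &
      forall w : seq nat, U (2 * k + 1) [:: 1; 3; 2] w -> swu (swd w) = w].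
Proof.
move: (2 * k + 1) => n.
have uK w : U n [:: 2; 3; 1] w -> swd (swu w) = w.
  case=> pw _ av; apply: (swuK pw); apply/avoids231 => //.
  by case: (is_perm_facts pw).
have dK w : U n [:: 1; 3; 2] w -> swu (swd w) = w.
  case=> pw _ av; apply: (swdK pw); apply/avoids132 => //.
  by case: (is_perm_facts pw).
split=> //; split.
- by move=> w; apply: swu_U.
- by move=> x y /set_mem/uK {2}<- /set_mem/uK {2}<- ->.
- by move=> w Uw; exists (swd w); [exact: swd_U | exact: dK].
- by move=> w; apply: swd_U.
- by move=> x y /set_mem/dK {2}<- /set_mem/dK {2}<- ->.
- by move=> w Uw; exists (swu w); [exact: swu_U | exact: uK].
Qed.
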